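(* Let $P=K[X]$ be endowed with $\sigma$ and a weight function $\mathrm{w}$ as in the context, and let $S=P[s;\sigma]$ be endowed with a monomial ordering. Let $I\subsetneq P$ be a $\mathrm{w}$-graded $\Sigma$-invariant ideal. If $G$ is an $s$-homogeneous Gröbner basis of the skew analogue $I^S$, then $G^P=\pi(G)$ is a Gröbner $\Sigma$-basis of $I$.
   Context: $K$ is a field, $X=\{x_0,x_1,\ldots\}$ a countable set of variables, $P=K[X]$ the commutative polynomial ring, $\mathrm{Mon}(P)$ its set of monomials (including 1). $\sigma:P\to P$ is an injective $K$-algebra endomorphism of infinite order mapping monomials to monomials, with $\gcd(\sigma(x_i),\sigma(x_j))=1$ for $i\neq j$. $S=P[s;\sigma]$ is the free left $P$-module with basis $\Sigma=\{s^i\}_{i\ge0}$ and multiplication determined by $sf=\sigma(f)s$; it is graded by $S_i=Ps^i$, whose elements are called $s$-homogeneous. $\mathrm{Mon}(S)=\{ms^i\mid m\in\mathrm{Mon}(P),i\ge0\}$. $S$ is endowed with a monomial ordering $\prec$: a total well-ordering of $\mathrm{Mon}(S)$ with $v\prec w\Rightarrow pvq\prec pwq$ for all $v,w,p,q\in\mathrm{Mon}(S)$; its restriction is used on $P$ (one then has $m\prec n\Rightarrow\sigma(m)\prec\sigma(n)$ on $\mathrm{Mon}(P)$). $\mathrm{lm}(f)$ is the largest monomial occurring in $f\ne0$, and $\mathrm{lm}(G)=\{\mathrm{lm}(f)\mid f\in G, f\ne0\}$. $\pi:S\to P$ is the $P$-linear map with $s^i\mapsto1$ for all $i$. $\Sigma$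 acts on $P$ by $s^i\cdot f=\sigma^i(f)$; an ideal $I\subset P$ is $\Sigma$-invariant if $\sigma(I)\subset I$. A subset $G\subset I$ is a Gröbner $\Sigma$-basis of $I$ if $\Sigma\cdot G=\{\sigma^i(g)\mid g\in G,i\ge0\}$ is a Gröbner basis of the ideal $I$ of $P$, i.e. $\mathrm{lm}(\Sigma\cdot G)$ and $\mathrm{lm}(I)$ generate the same ideal of $P$. A subset $G$ of a two-sided ideal $J\subset S$ is a Gröbner basis of $J$ if $\mathrm{lm}(G)$ and $\mathrm{lm}(J)$ generate the same two-sided ideal of $S$. Weights: $\hat{\mathbb{N}}=\{-\infty\}\cup\mathbb{N}$, with $\max(-\infty,x)=x$ and $-\infty+x=-\infty$. A weight function is a map $\mathrm{w}:\mathrm{Mon}(P)\to\hat{\mathbb{N}}$ with $\mathrm{w}(1)=-\infty$, $\mathrm{w}(x_i)\in\mathbb{N}$ for every variable, $\mathrm{w}(mn)=\max(\mathrm{w}(m),\mathrm{w}(n))$, $\mathrm{w}(\sigma(x_i))=1+\mathrm{w}(x_i)$. $P_i$ is the $K$-span of the monomials of weight $i$, so $P=\bigoplus_{i\in\hat{\mathbb{N}}}P_i$, $P_{-\infty}=K$. An ideal $I$ is $\mathrm{w}$-graded if $I=\sum_iI_i$ with $I_i=I\cap P_i$. For a $\mathrm{w}$-graded $\Sigma$-invariant ideal $I\subsetneq P$, its skew analogue $I^S$ is the two-sided ideal of $S$ generated by $\{fs^i\mid f\in I_i,i\ge0\}$. *)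

(* Defs.v *)
From HB Require Import structures.
From mathcomp Require Import all_boot all_order all_algebra.
From mathcomp Require Import boolp classical_sets.
From mathcomp Require Import monalg.

Set Implicit Arguments.
Unset Strict Implicit.
Unset Printing Implicit Defensive.

Import GRing.Theory.
Local Open Scope classical_set_scope.
Local Open Scope ring_scope.

(* Skew polynomials R[s; sigma]. The wrapped polynomial \sum_i a_i 'X^i stands *)
(* for \sum_i a_i s^i; the left R-module structure is that of {poly R}, while  *)
(* the product is determined by s a = sigma(a) s. The wrapper keeps the two    *)
(* products apart.                                                             *)
Record skewpoly (R : nzRingType) (sigma : {rmorphism R -> R}) : Type :=
  SkewPoly { skewval : {poly R} }.

Section SkewPoly.
Context {R : nzRingType} (sigma : {rmorphism R -> R}).
Local Notation S := (skewpoly sigma).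
Local Notation mkS := (@SkewPoly R sigma).
Implicit Types f g h : S.

HB.instance Definition _ := [isNew for @skewval R sigma].
HB.instance Definition _ := [Choice of skewpoly sigma by <:].

Definition szero : S := mkS 0.
Definition sopp f : S := mkS (- skewval f).
Definition sadd f g : S := mkS (skewval f + skewval g).
Definition sscale (a : R) f : S := mkS (a *: skewval f).

Lemma saddA : associative sadd.
Proof. by move=> f g h; apply: val_inj; rewrite /= addrA. Qed.
Lemma saddC : commutative sadd.
Proof. by move=> f g; apply: val_inj; rewrite /= addrC. Qed.
Lemma sadd0 : left_id szero sadd.
Proof. by move=> f; apply: val_inj; rewrite /= add0r. Qed.
Lemma saddN : left_inverse szero sopp sadd.
Proof. by move=> f; apply: val_inj; rewrite /= addNr. Qed.

HB.instance Definition _ := GRing.isZmodule.Build (skewpoly sigma)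
  saddA saddC sadd0 saddN.

Lemma sscaleA a b f : sscale a (sscale b f) = sscale (a * b) f.
Proof. by apply: val_inj; rewrite /= scalerA. Qed.
Lemma sscale1 : left_id 1 sscale.
Proof. by move=> f; apply: val_inj; rewrite /= scale1r. Qed.
Lemma sscaleDr : right_distributive sscale +%R.
Proof. by move=> a f g; apply: val_inj; rewrite /= scalerDr. Qed.
Lemma sscaleDl f : {morph sscale^~ f : a b / a + b}.
Proof. by move=> a b; apply: val_inj; rewrite /= scalerDl. Qed.

HB.instance Definition _ := GRing.Zmodule_isLmodule.Build R (skewpoly sigma)
  sscaleA sscale1 sscaleDr sscaleDl.

(* The coefficient a_i of \sum_i a_i s^i. *)
Definition scoef (f : S) (i : nat) : R := (skewval f)`_i.

(* (a s^i) (b s^j) = a sigma^i(b) s^(i+j) *)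
Definition smul (f g : S) : S :=
  mkS (\poly_(k < (size (skewval f) + size (skewval g)).-1)
    \sum_(i < k.+1) scoef f i * iter i sigma (scoef g (k - i))).

Definition sone : S := mkS 1.

Lemma iter_sigmaD i : {morph iter i sigma : a b / a + b}.
Proof. by move=> a b; elim: i => //= i ->; rewrite rmorphD. Qed.
Lemma iter_sigmaM i : {morph iter i sigma : a b / a * b}.
Proof. by move=> a b; elim: i => //= i ->; rewrite rmorphM. Qed.
Lemma iter_sigma0 i : iter i sigma 0 = 0.
Proof. by elim: i => //= i ->; rewrite rmorph0. Qed.
Lemma iter_sigma1 i : iter i sigma 1 = 1.
Proof. by elim: i => //= i ->; rewrite rmorph1. Qed.
Lemma iter_sigma_sum i I (r : seq I) (P : pred I) (F : I -> R) :
  iter i sigma (\sum_(j <- r | P j) F j)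
  = \sum_(j <- r | P j) iter i sigma (F j).
Proof.
by apply: (big_morph (iter i sigma) (iter_sigmaD i)); rewrite iter_sigma0.
Qed.

Lemma scoefP f g : scoef f =1 scoef g -> f = g.
Proof. by move=> eq_fg; apply/val_inj/polyP. Qed.

Lemma scoefD f g i : scoef (f + g) i = scoef f i + scoef g i.
Proof. exact: coefD. Qed.

Lemma scoefZ a f i : scoef (a *: f) i = a * scoef f i.
Proof. exact: coefZ. Qed.

Lemma scoef_smul f g k :
  scoef (smul f g) k
  = \sum_(i < k.+1) scoef f i * iter i sigma (scoef g (k - i)).
Proof.
rewrite {1}/scoef /= coef_poly ltn_predRL; case: leqP => // le_pq_i1.
rewrite big1 // => j _; rewrite /scoef.
have [lq_p_j|lt_j_p] := leqP (size (skewval f)) j.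
  by rewrite nth_default ?mul0r.
rewrite [X in iter _ _ X]nth_default ?iter_sigma0 ?mulr0 // leq_subRL -ltnS //.
by rewrite (leq_trans _ le_pq_i1) // ltn_add2r.
Qed.

Lemma scoef_smul_rev f g k :
  scoef (smul f g) k
  = \sum_(i < k.+1) scoef f (k - i) * iter (k - i) sigma (scoef g i).
Proof.
rewrite scoef_smul (reindex_inj rev_ord_inj) /=.
by apply: eq_bigr => j _; rewrite (sub_ordK j).
Qed.

Lemma scoef_sone i : scoef sone i = (i == 0)%:R.
Proof. exact: coef1. Qed.

Lemma smulA : associative smul.
Proof.
move=> p q r; apply: scoefP => i; rewrite scoef_smul scoef_smul_rev.
pose coef3 j k := scoef p j *
  (iter j sigma (scoef q (i - j - k)) * iter (i - k) sigma (scoef r k)).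
transitivity (\sum_(j < i.+1) \sum_(k < i.+1 | (k <= i - j)%N) coef3 j k).
  apply: eq_bigr => /= j _; rewrite scoef_smul_rev iter_sigma_sum big_distrr /=.
  rewrite (big_ord_narrow_leq (leq_subr _ _)).
  apply: eq_bigr => k _; rewrite /coef3 iter_sigmaM /= -iterD.
  have le_ji : (j <= i)%N by rewrite -ltnS.
  by rewrite addnBA ?subnKC // -ltnS.
rewrite (exchange_big_dep predT) //=; apply: eq_bigr => k _.
transitivity (\sum_(j < i.+1 | (j <= i - k)%N) coef3 j k).
  apply: eq_bigl => j; rewrite -ltnS -(ltnS j) -!subSn ?leq_ord //.
  by rewrite -subn_gt0 -(subn_gt0 j) -!subnDA addnC.
rewrite (big_ord_narrow_leq (leq_subr _ _)) scoef_smul big_distrl /=.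
by apply: eq_bigr => j _; rewrite /coef3 -!subnDA addnC mulrA.
Qed.

Lemma smul1l : left_id sone smul.
Proof.
move=> p; apply: scoefP => i; rewrite scoef_smul big_ord_recl subn0.
rewrite scoef_sone mul1r big1 ?addr0 // => j _.
by rewrite scoef_sone mul0r.
Qed.

Lemma smul1r : right_id sone smul.
Proof.
move=> p; apply: scoefP => i; rewrite scoef_smul_rev big_ord_recl subn0.
rewrite scoef_sone iter_sigma1 mulr1 big1 ?addr0 // => j _.
by rewrite scoef_sone iter_sigma0 mulr0.
Qed.

Lemma smulDl : left_distributive smul +%R.
Proof.
move=> p q r; apply: scoefP => i; rewrite scoefD !scoef_smul -big_split.
by apply: eq_bigr => j _; rewrite scoefD mulrDl.
Qed.

Lemma smulDr : right_distributive smul +%R.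
Proof.
move=> p q r; apply: scoefP => i; rewrite scoefD !scoef_smul -big_split.
by apply: eq_bigr => j _; rewrite scoefD iter_sigmaD mulrDr.
Qed.

Lemma sone_neq0 : sone != 0.
Proof. by rewrite -(inj_eq val_inj) /= oner_neq0. Qed.

HB.instance Definition _ := GRing.Zmodule_isNzRing.Build (skewpoly sigma)
  smulA smul1l smul1r smulDl smulDr sone_neq0.

Lemma scoefM f g k :
  scoef (f * g) k
  = \sum_(i < k.+1) scoef f i * iter i sigma (scoef g (k - i)).
Proof. exact: scoef_smul. Qed.

Lemma sscaleAl (a : R) f g : a *: (f * g) = a *: f * g.
Proof.
apply: scoefP => i; rewrite scoefZ !scoefM mulr_sumr.
by apply: eq_bigr => j _; rewrite scoefZ mulrA.
Qed.

HB.instance Definition _ :=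
  GRing.Lmodule_isLalgebra.Build R (skewpoly sigma) sscaleAl.

Definition svar : S := mkS 'X.

Lemma scoefX i : scoef svar i = (i == 1)%:R.
Proof. exact: coefX. Qed.

Lemma scoef_svarM f i :
  scoef (svar * f) i = if i is j.+1 then sigma (scoef f j) else 0.
Proof.
rewrite scoefM; case: i => [|i].
  by rewrite big_ord_recl big_ord0 scoefX mul0r addr0.
rewrite (bigD1 (inord 1)) //= inordK // scoefX mul1r subSS subn0 big1 ?addr0 //.
by move=> j /eqP/val_eqP/=; rewrite inordK // scoefX => /negPf->; rewrite mul0r.
Qed.

Lemma svar_comm (a : R) : svar * a%:A = sigma a *: svar.
Proof.
apply: scoefP => i; rewrite scoef_svarM scoefZ scoefX.
case: i => [|i]; rewrite ?mulr0 // scoefZ (_ : scoef 1 i = (i == 0)%:R).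
  by case: i => [|i]; rewrite ?mulr1 ?mulr0 ?rmorph0.
exact: scoef_sone.
Qed.

Lemma svarXn_comm i (a : R) :
  svar ^+ i * a%:A = iter i sigma a *: svar ^+ i.
Proof.
elim: i => [|i IH]; first by rewrite expr0 mul1r.
have e : iter i sigma a *: svar ^+ i = (iter i sigma a)%:A * svar ^+ i.
  by rewrite -scalerAl mul1r.
by rewrite exprS -mulrA IH e mulrA svar_comm -scalerAl.
Qed.

Lemma smonomialM i j (a b : R) :
  (a *: svar ^+ i) * (b *: svar ^+ j) = (a * iter i sigma b) *: svar ^+ (i + j).
Proof.
have -> : b *: svar ^+ j = b%:A * svar ^+ j by rewrite -scalerAl mul1r.
by rewrite mulrA -scalerAl svarXn_comm -!scalerAl -exprD scalerA.
Qed.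

Lemma svarXn n : skewval (svar ^+ n) = 'X^n.
Proof.
apply/polyP; elim: n => [|n IHn] i; first by rewrite !expr0.
rewrite exprS -[LHS]/(scoef (svar * svar ^+ n) i) scoef_svarM /scoef coefXn; case: i => // i.
by rewrite IHn coefXn; rewrite eqSS rmorph_nat.
Qed.

(* The elements of S_i = R s^i. *)
Definition shomogeneous (i : nat) : set S := [set a *: svar ^+ i | a in setT].

(* The R-linear map sending every s^i to 1. *)
Definition spi (f : S) : R := \sum_(i < size (skewval f)) scoef f i.

Lemma spi_widen n f : (size (skewval f) <= n)%N ->
  spi f = \sum_(i < n) scoef f i.
Proof.
move=> le_fn; rewrite /spi (big_ord_widen n (scoef f) le_fn) big_mkcond /=.
by apply: eq_bigr => i _; case: ltnP => // le_fi; rewrite /scoef nth_default.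
Qed.

Lemma spi_is_scalar : scalar spi.
Proof.
move=> a f g; pose n := maxn (size (skewval f)) (size (skewval g)).
rewrite (@spi_widen n f) ?leq_maxl // (@spi_widen n g) ?leq_maxr //.
rewrite (@spi_widen n).
  rewrite mulr_sumr -big_split; apply: eq_bigr => i _.
  by rewrite scoefD scoefZ.
rewrite (leq_trans (size_polyD _ _)) // geq_max leq_maxr andbT.
by rewrite (leq_trans (size_scale_leq _ _)) // leq_maxl.
Qed.

Lemma spi_svarXn n : spi (svar ^+ n) = 1.
Proof.
rewrite (@spi_widen n.+1) ?svarXn ?size_polyXn // (bigD1 ord_max) //=.
rewrite /scoef svarXn coefXn eqxx big1 ?addr0 // => i ne_in.
by rewrite coefXn -[_ == n]/(i == ord_max) (negPf ne_in).
Qed.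

End SkewPoly.

Arguments spi {R sigma} f.

(* Ideals of a ring; in a commutative ring these are the usual ones. *)

Record two_sided_ideal (R : nzRingType) (J : set R) : Prop := TwoSidedIdeal {
  ideal0 : J 0;
  idealD : forall x y, J x -> J y -> J (x + y);
  idealMl : forall a x, J x -> J (a * x);
  idealMr : forall a x, J x -> J (x * a) }.

Definition ideal_gen (R : nzRingType) (A : set R) : set R :=
  smallest (@two_sided_ideal R) A.

(* P = K[x_0, x_1, ...], with monomials {cmonom nat}: m : {cmonom nat} is the  *)
(* exponent function and <<m>> the corresponding element of P.                 *)

Notation Mon := {cmonom nat}.
Notation Pol K := {malg K[{cmonom nat}]}.

Definition pvar (K : fieldType) (i : nat) : Pol K := << ucm i >>.

Section Endomorphism.
Context {K : fieldType} (sigma : {lrmorphism Pol K -> Pol K}).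

Definition infinite_order :=
  forall i j : nat, iter i sigma =1 iter j sigma -> i = j.

Definition monomial_map := forall m : Mon, exists n : Mon, sigma << m >> = << n >>.

Definition pdvd (d f : Pol K) := exists q, f = q * d.

(* gcd(f, g) = 1 *)
Definition pgcd1 (f g : Pol K) := forall d, pdvd d f -> pdvd d g -> pdvd d 1.

Definition coprime_images := forall i j : nat, i != j ->
  pgcd1 (sigma (pvar K i)) (sigma (pvar K j)).

Definition sigma_invariant (I : set (Pol K)) := sigma @` I `<=` I.

(* Sigma . A, for Sigma = {s^i} acting by s^i . f = sigma^i(f) *)
Definition sigma_orbit (A : set (Pol K)) : set (Pol K) :=
  [set f | exists i g, A g /\ f = iter i sigma g].

End Endomorphism.

(* The pair (m, i) encodes the monomial m s^i of S. *)
Definition SMon : Type := (Mon * nat)%type.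

Definition smon (K : fieldType) (sigma : {lrmorphism Pol K -> Pol K})
    (v : SMon) : skewpoly sigma :=
  (<< v.1 >> : Pol K) *: svar sigma ^+ v.2.

(* prec is strict. Mon(S) is closed under products when sigma maps monomials   *)
(* to monomials; v' and w' below are the pairs encoding p v q and p w q.       *)
Record monomial_ordering (K : fieldType) (sigma : {lrmorphism Pol K -> Pol K})
    (prec : SMon -> SMon -> Prop) : Prop := MonomialOrdering {
  prec_irr : forall v, ~ prec v v;
  prec_trans : forall u v w, prec u v -> prec v w -> prec u w;
  prec_total : forall v w, prec v w \/ v = w \/ prec w v;
  prec_wf : well_founded prec;
  prec_mul : forall v w p q v' w' : SMon, prec v w ->
    smon sigma p * smon sigma v * smon sigma q = smon sigma v' ->
    smon sigma p * smon sigma w * smon sigma q = smon sigma w' ->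
    prec v' w' }.

(* v is the largest element of the set A *)
Definition is_largest (M : Type) (prec : M -> M -> Prop) (A : set M) (v : M) :=
  A v /\ forall u, A u -> u <> v -> prec u v.

Section LeadingMonomials.
Context {K : fieldType} {sigma : {lrmorphism Pol K -> Pol K}}.
Context (prec : SMon -> SMon -> Prop).

Definition precP (m n : Mon) := prec (m, 0%N) (n, 0%N).

Definition is_lmP (f : Pol K) (m : Mon) :=
  is_largest precP [set n | f@_n != 0] m.

Definition is_lmS (f : skewpoly sigma) (v : SMon) :=
  is_largest prec [set u | (scoef f u.2)@_(u.1) != 0] v.

(* 0 has no leading monomial in the sense of is_lmP and is_lmS, so it          *)
(* contributes nothing to lm(A).                                               *)
Definition lmP (A : set (Pol K)) : set (Pol K) :=
  [set g | exists f m, [/\ A f, is_lmP f m & g = << m >>]].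

Definition lmS (A : set (skewpoly sigma)) : set (skewpoly sigma) :=
  [set g | exists f v, [/\ A f, is_lmS f v & g = smon sigma v]].

Definition groebner_basisP (I G : set (Pol K)) :=
  G `<=` I /\ ideal_gen (lmP G) = ideal_gen (lmP I).

Definition groebner_basisS (J G : set (skewpoly sigma)) :=
  G `<=` J /\ ideal_gen (lmS G) = ideal_gen (lmS J).

End LeadingMonomials.

Definition groebner_sigma_basis (K : fieldType)
    (sigma : {lrmorphism Pol K -> Pol K}) (prec : SMon -> SMon -> Prop)
    (I G : set (Pol K)) :=
  G `<=` I /\ groebner_basisP prec I (sigma_orbit sigma G).

(* N extended by -oo, which is encoded by None. *)
Notation hatN := (option nat).

Definition hatN_max (a b : hatN) : hatN :=
  match a, b with
  | None, _ => b
  | _, None => a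
  | Some i, Some j => Some (maxn i j)
  end.

Definition hatN_add (a b : hatN) : hatN :=
  if (a, b) is (Some i, Some j) then Some (i + j)%N else None.

Record weight_function (K : fieldType) (sigma : {lrmorphism Pol K -> Pol K})
    (w : Mon -> hatN) : Prop := WeightFunction {
  weight1 : w (@mone Mon) = None;
  weight_var : forall i : nat, exists k : nat, w (ucm i) = Some k;
  weightM : forall m n : Mon, w (mmul m n) = hatN_max (w m) (w n);
  weight_sigma : forall (i : nat) (n : Mon), sigma (pvar K i) = << n >> ->
    w n = hatN_add (Some 1%N) (w (ucm i)) }.

Section WeightGrading.
Context {K : fieldType} (w : Mon -> hatN).

(* P_i, for i in hatN *)
Definition wpart (i : hatN) : set (Pol K) :=
  [set f | forall m, f@_m != 0 -> w m = i].

(* I = \sum_i (I `&` P_i), the sum of a family of subspaces *)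
Definition wgraded (I : set (Pol K)) :=
  I = [set f | exists (r : seq hatN) (F : hatN -> Pol K),
         (forall i, (I `&` wpart i) (F i)) /\ f = \sum_(i <- r) F i].

Definition skew_analogue (sigma : {lrmorphism Pol K -> Pol K})
    (I : set (Pol K)) : set (skewpoly sigma) :=
  ideal_gen [set g | exists (i : nat) (f : Pol K),
    (I `&` wpart (Some i)) f /\ g = f *: svar sigma ^+ i].

End WeightGrading.

(* Main.v *)
(* Only two facts about I^S matter: its elements have all their coefficients   *)
(* in I, and it contains f s^i for f in I_i. Let L be the ideal of P generated *)
(* by lm(Sigma . pi(G)). As sigma respects the ordering, it commutes with lm,  *)
(* so L is Sigma-invariant and the elements of S with coefficients in L form a *)
(* two-sided ideal; it contains lm(G), hence lm(I^S). If m is the leading      *)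
(* monomial of some element of I, it is also the leading monomial of its       *)
(* component f of weight i = w(m), and m s^i = lm(f s^i) lies in lm(I^S), so   *)
(* that m lies in L.                                                           *)

Require Import Defs.
From HB Require Import structures.
From mathcomp Require Import all_boot all_order all_algebra.
From mathcomp Require Import boolp classical_sets.
From mathcomp Require Import monalg.

Set Implicit Arguments.
Unset Strict Implicit.
Unset Printing Implicit Defensive.

Import GRing.Theory.
Local Open Scope classical_set_scope.
Local Open Scope ring_scope.

(** Membership in an ideal of $S$ is tested on coefficients: [ideal_scoef] turns a $\sigma$-stable
    ideal of $P$ into a two-sided ideal of $S$. It is applied to [I], which bounds $I^S$ from above,
    and to the ideal L generated by the leading monomials of the orbit of $\pi(G)$, which is stable
    by [ideal_gen_lmP_sigma]. For $s$-homogeneous elements, [is_lmS_ZXn] identifies leading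
    monomials in $S$ with those in $P$. Finally [wgraded_component] and [proper_weight] lift a
    leading monomial m of [I] to some $m s^i$ in $\mathrm{lm}(I^S)$. *)

Lemma iter_stable (T : Type) (A : set T) (f : T -> T) n x :
  (forall y, A y -> A (f y)) -> A x -> A (iter n f x).
Proof. by move=> Af Ax; elim: n => //= n; apply: Af. Qed.

Section Ideals.
Context {R : nzRingType}.
Implicit Types A I : set R.

Lemma ideal_gen_ideal A : two_sided_ideal (ideal_gen A).
Proof.
split=> [|x y Ax Ay|a x Ax|a x Ax] J [idJ sAJ].
- exact: ideal0.
- by apply: (idealD idJ); [apply: Ax|apply: Ay].
- by apply: (idealMl idJ); apply: Ax.
- by apply: (Defs.idealMr idJ); apply: Ax.
Qed.

Lemma ideal_sum I (T : Type) (r : seq T) (Q : pred T) (F : T -> R) :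
  two_sided_ideal I -> (forall i, Q i -> I (F i)) ->
  I (\sum_(i <- r | Q i) F i).
Proof.
by move=> idI IF; apply: (big_ind I) => //; [apply: ideal0|apply: idealD].
Qed.

Lemma ideal_preim I (f : {rmorphism R -> R}) :
  two_sided_ideal I -> two_sided_ideal (f @^-1` I).
Proof.
move=> idI; split=> [|x y Ix Iy|a x Ix|a x Ix]; rewrite /preimage /=.
- by rewrite rmorph0; apply: ideal0.
- by rewrite rmorphD; apply: (idealD idI).
- by rewrite rmorphM; apply: (idealMl idI).
- by rewrite rmorphM; apply: (Defs.idealMr idI).
Qed.

(** Stability under [sigma] serves left multiplication: moving a coefficient past $s^i$ applies
    $\sigma^i$ to it. *)
Lemma ideal_scoef I (sigma : {rmorphism R -> R}) :
  two_sided_ideal I -> (forall x, I x -> I (sigma x)) ->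
  two_sided_ideal [set f : skewpoly sigma | forall k, I (scoef f k)].
Proof.
move=> idI sI; split=> [k|f g If Ig k|a f If k|a f If k] /=.
- by rewrite /scoef /= coef0; apply: ideal0.
- by rewrite scoefD; apply: (idealD idI).
- rewrite scoefM; apply: ideal_sum => // i _.
  by apply: (idealMl idI); apply: iter_stable.
- by rewrite scoefM; apply: ideal_sum => // i _; apply: (Defs.idealMr idI).
Qed.

End Ideals.

Section Skew.
Context {R : nzRingType} (sigma : {rmorphism R -> R}).

Lemma scoefZXn (a : R) i k :
  scoef (a *: svar sigma ^+ i) k = if k == i then a else 0.
Proof.
by rewrite scoefZ /scoef svarXn coefXn; case: (k == i); rewrite (mulr1, mulr0).
Qed.

Lemma spiZXn (a : R) i : spi (a *: svar sigma ^+ i) = a.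
Proof.
have := spi_is_scalar a (svar sigma ^+ i) 0.
rewrite addr0 spi_svarXn mulr1 => ->.
by rewrite /spi /= big1 ?addr0 // => j _; rewrite /scoef coef0.
Qed.

End Skew.

Section Monomials.
Context {K : fieldType} (sigma : {lrmorphism Pol K -> Pol K}).

Lemma monomial_inj : injective (fun m : Mon => << m >> : Pol K).
Proof.
move=> m n /(congr1 (mcoeff m))/esym; rewrite [LHS]mcoeffU [RHS]mcoeffU eqxx.
by case: eqP => // _ /esym/eqP; rewrite oner_eq0.
Qed.

Lemma malgUZ (x : K) (m : Mon) : << x *g m >> = x *: << m >> :> Pol K.
Proof.
apply/malgP => n; rewrite [LHS]mcoeffU [RHS]mcoeffZ [in RHS]mcoeffU.
by rewrite mulr_natr.
Qed.

Context (sm : Mon -> Mon) (smP : forall m, sigma << m >> = << sm m >>).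

Lemma sigmaE f :
  sigma f = \sum_(m <- finmap.enum_fset (msupp f)) << f@_m *g sm m >>.
Proof.
rewrite {1}[f]monalgE rmorph_sum; apply: eq_bigr => m _.
by rewrite /= [in LHS]malgUZ linearZ /= smP [RHS]malgUZ.
Qed.

Lemma mcoeff_sigma_supp f n :
  (sigma f)@_n != 0 -> exists2 m, f@_m != 0 & n = sm m.
Proof.
rewrite sigmaE raddf_sum /=; apply: contra_neqP => Nex.
rewrite big_seq big1 // => m fm; rewrite mcoeffU; case: eqP => // smE.
by case: Nex; exists m; rewrite // mcoeff_neq0.
Qed.

(** Injectivity of [sigma] passes to [sm], so distinct monomials of [f] cannot merge. *)
Lemma mcoeff_sigma f m : injective sigma -> (sigma f)@_(sm m) = f@_m.
Proof.
move=> sigma_inj; rewrite sigmaE raddf_sum [in RHS](monalgE f) raddf_sum /=.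
apply: eq_bigr => n _; rewrite [LHS]mcoeffU [RHS]mcoeffU; congr (_ *+ _).
congr nat_of_bool; apply/eqP/eqP => [smE|-> //].
by apply: monomial_inj; apply: sigma_inj; rewrite [LHS]smP [RHS]smP smE.
Qed.

End Monomials.

Section Ordering.
Context {K : fieldType} (sigma : {lrmorphism Pol K -> Pol K}).
Context (prec : SMon -> SMon -> Prop) (prec_ord : monomial_ordering sigma prec).

Lemma smonXn i : smon sigma (@mone Mon, i) = svar sigma ^+ i.
Proof. exact: scale1r. Qed.

Lemma prec_shift (m n : Mon) i : precP prec m n -> prec (m, i) (n, i).
Proof.
move=> mn; apply: (@prec_mul _ _ _ prec_ord _ _ (@mone Mon, 0%N) (@mone Mon, i) _ _ mn);
  by rewrite !smonXn expr0 mul1r /smon expr0 -scalerAl mul1r.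
Qed.

(** Totality: the opposite comparison would be preserved by [prec_shift]. *)
Lemma prec_unshift (m n : Mon) i : prec (m, i) (n, i) -> precP prec m n.
Proof.
move=> mn; have [//|[[mEn]|nm]] := prec_total prec_ord (m, 0%N) (n, 0%N).
  by move: mn; rewrite mEn => /(prec_irr prec_ord).
have /(prec_trans prec_ord mn) := prec_shift i nm.
by move/(prec_irr prec_ord).
Qed.

Lemma is_lmS_ZXn (f : Pol K) i v :
  is_lmS prec (f *: svar sigma ^+ i) v <-> v.2 = i /\ is_lmP prec f v.1.
Proof.
case: v => m k; rewrite /is_lmS /is_lmP /is_largest /= scoefZXn; split.
  case; have [<-{i} fm max_m|] := eqVneq k i; last by rewrite mcoeff0 eqxx.
  do 2![split=> //] => n fn nm; apply: (@prec_unshift _ _ k).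
  by apply: max_m; [rewrite /= scoefZXn eqxx|case].
case=> -> [fm max_m]; rewrite eqxx; split=> // -[n l] /=.
rewrite scoefZXn; have [-> fn nm|] := eqVneq l i; last by rewrite mcoeff0 eqxx.
by apply/prec_shift/max_m => // nE; rewrite nE in nm.
Qed.

Context (sigma_inj : injective sigma).
Context (sm : Mon -> Mon) (smP : forall m, sigma << m >> = << sm m >>).

(** Since $s m = \sigma(m) s$, multiply by $s$ on the left, then cancel it on the right. *)
Lemma precP_sigma m n : precP prec m n -> precP prec (sm m) (sm n).
Proof.
move=> mn; apply: (@prec_unshift _ _ 1).
apply: (@prec_mul _ _ _ prec_ord _ _ (@mone Mon, 1%N) (@mone Mon, 0%N) _ _ mn);
  by rewrite !smonXn expr0 mulr1 /smon expr0 expr1 svar_comm /= smP.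
Qed.

Lemma is_lmP_sigma f m : is_lmP prec f m -> is_lmP prec (sigma f) (sm m).
Proof.
case=> /= fm max_m; split=> [|n /= /(mcoeff_sigma_supp smP)[k fk ->] smN].
  by rewrite /= (mcoeff_sigma smP).
by apply/precP_sigma/max_m => // kE; rewrite kE in smN.
Qed.

(** The preimage of an ideal under [sigma] is an ideal, so generators suffice; on them [sigma]
    commutes with taking leading monomials. *)
Lemma ideal_gen_lmP_sigma A (f : Pol K) : (forall g, A g -> A (sigma g)) ->
  ideal_gen (lmP prec A) f -> ideal_gen (lmP prec A) (sigma f).
Proof.
move=> sA; move: f; apply: smallest_sub.
  exact: ideal_preim (ideal_gen_ideal _).
move=> _ [f [m [Af fm ->]]]; rewrite /preimage /= smP.
apply: sub_gen_smallest; exists (sigma f), (sm m); split=> //; first exact: sA.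
exact: is_lmP_sigma.
Qed.

End Ordering.

Section Weights.
Context {K : fieldType} (sigma : {lrmorphism Pol K -> Pol K}).
Context (w : Mon -> hatN) (w_weight : weight_function sigma w).

(** A variable dividing [m] would contribute a finite weight to the maximum. *)
Lemma weight_None m : w m = None -> m = @mone Mon.
Proof.
move=> wm; apply/eqP/cmP => i; rewrite cm1; apply/eqP/negPn/negP => mi.
have mE : m = mmul (ucm i) (divcm m (ucm i)).
  apply/eqP/cmP => j; rewrite mulcmE divcmE ucmE subnKC //.
  by case: eqP => // <-; rewrite lt0n.
have [k wi] := weight_var w_weight i.
by move: wm; rewrite mE (weightM w_weight) wi; case: (w _).
Qed.

(* The components of f may be repeated in the sum provided by [wgraded], hence  *)
(* the partial sum instead of a single component.                               *)
Lemma wgraded_component (I : set (Pol K)) f m :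
  two_sided_ideal I -> wgraded w I -> I f ->
  exists2 g, (I `&` wpart w (w m)) g & forall n, w n = w m -> g@_n = f@_n.
Proof.
move=> idI; rewrite /wgraded => IE; rewrite {1}IE => -[r [F [IF ->]]].
exists (\sum_(i <- r | i == w m) F i).
  split; first by apply: ideal_sum => // i _; have [] := IF i.
  move=> n; rewrite raddf_sum /=; apply: contra_neqP => wn.
  rewrite big1 // => i /eqP->; apply/eqP/negPn/negP => Fn.
  by apply: wn; have [_] := IF (w m); apply.
move=> n wn; rewrite !raddf_sum /= big_mkcond; apply: eq_bigr => i _.
case: eqP => // iwm; apply/esym/eqP/negPn/negP => Fn.
by apply: iwm; rewrite -wn; have [_ /(_ n Fn)] := IF i.
Qed.

(** In weight $-\infty$, [f] would be a nonzero constant, a unit of $P$ lying in [I]. *)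
Lemma proper_weight (I : set (Pol K)) f m :
  two_sided_ideal I -> I <> setT -> I f -> wpart w (w m) f -> f@_m != 0 ->
  exists i, w m = Some i.
Proof.
move=> idI I_proper If wf fm; case wm: (w m) => [i|]; first by exists i.
case: I_proper; apply/seteqP; split=> // g _.
suff I1 : I 1 by rewrite -[g]mulr1; apply: (idealMl idI).
have m1 := weight_None wm.
have fE : f = (f@_m)%:MP.
  apply/malgP => n; rewrite mcoeffC; case: eqP => [->|n1]; first by rewrite m1.
  rewrite mulr0n; apply/eqP/negPn/negP => /wf; rewrite wm => /weight_None.
  exact: n1.
have := idealMl idI (f@_m)^-1%:MP If.
by rewrite [X in _ * X]fE -mpolyCM (mulVf fm).
Qed.

End Weights.

Theorem proposition5p19 (K : fieldType)
    (sigma : {lrmorphism Pol K -> Pol K})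
    (sigma_inj : injective sigma)
    (sigma_inf : infinite_order sigma)
    (sigma_mon : monomial_map sigma)
    (sigma_gcd : coprime_images sigma)
    (w : Mon -> hatN) (w_weight : weight_function sigma w)
    (prec : SMon -> SMon -> Prop) (prec_ord : monomial_ordering sigma prec)
    (I : set (Pol K)) (I_ideal : two_sided_ideal I) (I_proper : I <> setT)
    (I_graded : wgraded w I) (I_inv : sigma_invariant sigma I)
    (G : set (skewpoly sigma))
    (G_homog : forall g, G g -> exists i : nat, shomogeneous i g)
    (G_groebner : groebner_basisS prec (skew_analogue w I) G) :
  groebner_sigma_basis sigma prec I (spi @` G).
Proof.
have sI x : I x -> I (sigma x) by move=> Ix; apply: I_inv; exists x.
have [sm smP] := choice sigma_mon.
have [sGJ lmGJ] := G_groebner.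
have sJI (f : skewpoly sigma) : skew_analogue w I f -> forall k, I (scoef f k).
  move: f; apply: smallest_sub; first exact: ideal_scoef I_ideal sI.
  move=> _ [i [f [[If _] ->]]] k; rewrite scoefZXn.
  by case: ifP => // _; apply: ideal0.
have sGI : spi @` G `<=` I.
  by move=> _ [g Gg <-]; apply: ideal_sum => // i _; apply: sJI; apply: sGJ.
set A := sigma_orbit sigma (spi @` G).
have sAI : A `<=` I.
  by move=> _ [i [g [Gg ->]]]; apply: iter_stable => //; apply: sGI.
have sA f : A f -> A (sigma f) by case=> i [g [Gg ->]]; exists i.+1, g.
have sL := ideal_gen_lmP_sigma prec_ord sigma_inj smP sA.
have idL := ideal_gen_ideal (lmP prec A).
split=> //; split=> //; apply/seteqP; split; apply: smallest_sub.
- exact: ideal_gen_ideal.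
- move=> _ [f [m [Af fm ->]]]; apply: sub_gen_smallest.
  by exists f, m; split=> //; apply: sAI.
- exact: idL.
move=> _ [f [m [If [/= fm max_m] ->]]].
have [g [Ig wg] gE] := wgraded_component m I_ideal I_graded If.
have gm : g@_m != 0 by rewrite gE.
have [i wm] := proper_weight w_weight I_ideal I_proper Ig wg gm.
have lm_g : is_lmP prec g m.
  by split=> // n /= gn; apply: max_m; rewrite /= -gE // wg.
(* Taking the weight of [m] as exponent makes $g s^i$ a generator of $I^S$. *)
have lmJ : ideal_gen (lmS prec (skew_analogue w I)) (smon sigma (m, i)).
  apply: sub_gen_smallest; exists (g *: svar sigma ^+ i), (m, i); split=> //.
    by apply: sub_gen_smallest; exists i, g; rewrite -wm.
  by apply/(is_lmS_ZXn prec_ord).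
(* All coefficients are considered at once, so that the claim is membership in a two-sided ideal of
   $S$ and can be checked on $\mathrm{lm}(G)$. *)
have /(_ i) : forall k, ideal_gen (lmP prec A) (scoef (smon sigma (m, i)) k).
  rewrite -lmGJ in lmJ; move: lmJ; move: (smon _ _).
  apply: smallest_sub; first exact: (@ideal_scoef _ _ sigma idL sL).
  move=> _ [h [v [Gh + ->]]] k.
  (* By homogeneity $h = a s^j$, so $\pi(h) = a$ and the $P$-part of $\mathrm{lm}(h)$ is
     $\mathrm{lm}(a)$. *)
  have [j [a _ hE]] := G_homog h Gh; rewrite -hE => /(is_lmS_ZXn prec_ord)[_ av].
  rewrite scoefZXn; case: ifP => _; last exact: ideal0.
  apply: sub_gen_smallest; exists a, v.1; split=> //.
  by exists 0, a; split=> //; exists h => //; rewrite -hE spiZXn.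
by rewrite scoefZXn eqxx.
Qed.
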